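(* Let $F:\mathbb{R}^m\to\mathbb{R}^m$ be monotone and $L$-Lipschitz continuous ($L>0$), let $r:\mathbb{R}^m\to\mathbb{R}\cup\{+\infty\}$ be proper, convex and lower semicontinuous, let $B\subset\mathbb{R}^m$ be compact with diameter $D:=\sup_{w,z\in B}\|z-w\|$, and let $z_0\in B$. Let $(w_k)_{k\ge 0}$ be generated, for a constant step size $\alpha_k=\alpha>0$, by the iteration, for $k\ge 0$, $$w_k=\operatorname{prox}_{\alpha_k r}\big(z_k-\alpha_k F(\diamondsuit_k)\big),\qquad z_{k+1}=w_k+\alpha_k\big(F(\diamondsuit_k)-F(w_k)\big).$$ Suppose that one of the following choices is made: (i) (FBF) $\diamondsuit_k=z_k$ for all $k\ge 0$ and $\alpha\le \frac{1}{L}$; or (ii) (FBFp) $\diamondsuit_k=w_{k-1}$ for all $k\ge 0$, with $w_{-1}=z_0$, and $\alpha\le\frac{1}{2L}$. Then for all $K\ge 1$ the averaged iterates $\bar w_K:=\frac1K\sum_{k=0}^{K-1}w_k$ satisfy $$G_B(\bar w_K)\le\frac{D^2}{2\alpha K},$$ where $G_B$ is the restricted (unifying) gap function defined in the context.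
   Context: For $\lambda>0$, $\operatorname{prox}_{\lambda r}(w):=\operatorname{argmin}_{w'\in\mathbb{R}^m}\{r(w')+\frac{1}{2\lambda}\|w'-w\|^2\}$. Minimax case: we say that $F$ and $r$ come from a minimax problem if $m=d+n$ and there are a convex-concave differentiable function $\Phi:\mathbb{R}^d\times\mathbb{R}^n\to\mathbb{R}$ (convex in the first, concave in the second argument) with $L$-Lipschitz continuous gradient and proper, convex, lower semicontinuous functions $f:\mathbb{R}^d\to\mathbb{R}\cup\{+\infty\}$, $h:\mathbb{R}^n\to\mathbb{R}\cup\{+\infty\}$ such that $F(x,y)=(\nabla_x\Phi(x,y),-\nabla_y\Phi(x,y))$ and $r(x,y)=f(x)+h(y)$. In this case put $\Psi(x,y):=f(x)+\Phi(x,y)-h(y)$; the associated problem is $\min_{x}\max_{y}\Psi(x,y)$. The restricted (unifying) gap function with respect to $B$ is, for $w\in\mathbb{R}^m$ (written $w=(u,v)\in\mathbb{R}^d\times\mathbb{R}^n$ in the minimax case), $$G_B(w):=\begin{cases}\sup_{(x,y)\in B}\ \Psi(u,y)-\Psi(x,v) & \text{if } F \text{ and } r \text{ come from a minimax problem},\\ \sup_{z\in B}\ \langle F(z),w-z\rangle+r(w)-r(z) & \text{otherwise.}\end{cases}$$ (So the claim asserts the bound for the second expression for general $F,r$, and for the first expression in the minimax case.) *)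

(* Defs.v *)
From HB Require Import structures.
From mathcomp Require Import all_boot all_order all_algebra.
From mathcomp Require Import all_classical all_reals all_analysis.

Set Implicit Arguments.
Unset Strict Implicit.
Unset Printing Implicit Defensive.

Import Order.TTheory GRing.Theory Num.Theory.
Import numFieldNormedType.Exports.

Local Open Scope classical_set_scope.
Local Open Scope ring_scope.

Section Euclidean.
Context {R : realType}.

Definition dotv {m : nat} (u v : 'rV[R]_m) : R := (u *m v^T) 0 0.

(* The Euclidean norm: the library norm `|u| on matrices is the sup norm. It
   induces the same topology, so the library notions of compactness,
   differentiability and lower semicontinuity are used unchanged. *)
Definition enorm {m : nat} (u : 'rV[R]_m) : R := Num.sqrt (dotv u u).

Definition diam {m : nat} (B : set 'rV[R]_m) : R :=
  sup [set enorm (p.2 - p.1) | p in B `*` B].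

Definition elipschitz {m : nat} (L : R) (F : 'rV[R]_m -> 'rV[R]_m) : Prop :=
  forall x y, enorm (F x - F y) <= L * enorm (x - y).

Definition monotone_op {m : nat} (F : 'rV[R]_m -> 'rV[R]_m) : Prop :=
  forall x y, 0 <= dotv (F x - F y) (x - y).

Definition grad {m : nat} (f : 'rV[R]_m -> R) (x : 'rV[R]_m) : 'rV[R]_m :=
  \row_(i < m) 'D_(delta_mx 0 i) (f : 'rV[R]_m -> R^o) x.

End Euclidean.

Section ExtendedFunctions.
Context {R : realType}.
Local Open Scope ereal_scope.

Definition proper_fun {m : nat} (r : 'rV[R]_m -> \bar R) : Prop :=
  (forall x, r x != -oo) /\ (exists x, r x != +oo).

(* At t = 0 and t = 1 this relies on the convention 0 * +oo = 0. *)
Definition econvex {m : nat} (r : 'rV[R]_m -> \bar R) : Prop :=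
  forall (x y : 'rV[R]_m) (t : R), (0 <= t <= 1)%R ->
    r (t *: x + (1 - t) *: y)%R <= t%:E * r x + (1 - t)%:E * r y.

Definition proper_convex_lsc {m : nat} (r : 'rV[R]_m -> \bar R) : Prop :=
  [/\ proper_fun r, econvex r & lower_semicontinuous r].

Definition argmin {T : Type} (f : T -> \bar R) : set T :=
  [set x | forall y, f x <= f y].

(* For r proper, convex and lower semicontinuous and 0 < lambda, the argmin is
   a singleton, so the default value 0 is never used. *)
Definition prox {m : nat} (lambda : R) (r : 'rV[R]_m -> \bar R)
    (w : 'rV[R]_m) : 'rV[R]_m :=
  xget 0%R
    (argmin (fun w' => r w' + ((2 * lambda)^-1 * enorm (w' - w) ^+ 2)%:E)).

Definition gap_vi {m : nat} (F : 'rV[R]_m -> 'rV[R]_m) (r : 'rV[R]_m -> \bar R)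
    (B : set 'rV[R]_m) (w : 'rV[R]_m) : \bar R :=
  ereal_sup [set (dotv (F z) (w - z))%:E + r w - r z | z in B].

End ExtendedFunctions.

Section Minimax.
Context {R : realType} {m d n : nat}.

(* The two blocks of w = (u, v), where 'rV_m is R^d x R^n through e. *)
Definition xpart (e : m = (d + n)%N) (w : 'rV[R]_m) : 'rV[R]_d :=
  lsubmx (castmx (erefl 1%N, e) w).

Definition ypart (e : m = (d + n)%N) (w : 'rV[R]_m) : 'rV[R]_n :=
  rsubmx (castmx (erefl 1%N, e) w).

Definition joint (Phi : 'rV[R]_d -> 'rV[R]_n -> R) (p : 'rV[R]_(d + n)) : R :=
  Phi (lsubmx p) (rsubmx p).

Record from_minimax (L : R) (F : 'rV[R]_m -> 'rV[R]_m)
    (r : 'rV[R]_m -> \bar R) (e : m = (d + n)%N)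
    (Phi : 'rV[R]_d -> 'rV[R]_n -> R)
    (f : 'rV[R]_d -> \bar R) (h : 'rV[R]_n -> \bar R) : Prop := FromMinimax {
  mm_convex : forall y, convex_function [set: 'rV[R]_d] (fun x => Phi x y);
  mm_concave : forall x, convex_function [set: 'rV[R]_n] (fun y => - Phi x y);
  mm_diff : forall p, differentiable (joint Phi : _ -> R^o) p;
  mm_lipschitz : elipschitz L (grad (joint Phi));
  mm_f : proper_convex_lsc f;
  mm_h : proper_convex_lsc h;
  mm_F : forall w,
    xpart e (F w) = grad (fun x => Phi x (ypart e w)) (xpart e w) /\
    ypart e (F w) = - grad (fun y => Phi (xpart e w) y) (ypart e w);
  mm_r : forall w, r w = (f (xpart e w) + h (ypart e w))%E }.

Local Open Scope ereal_scope.

Definition saddle (Phi : 'rV[R]_d -> 'rV[R]_n -> R)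
    (f : 'rV[R]_d -> \bar R) (h : 'rV[R]_n -> \bar R)
    (x : 'rV[R]_d) (y : 'rV[R]_n) : \bar R :=
  f x + (Phi x y)%:E - h y.

(* If w = (u, v) has finite f u and h v, no indeterminate +oo - +oo occurs:
   the difference is -oo exactly when f or h is +oo at the blocks of z. *)
Definition gap_minimax (e : m = (d + n)%N) (Phi : 'rV[R]_d -> 'rV[R]_n -> R)
    (f : 'rV[R]_d -> \bar R) (h : 'rV[R]_n -> \bar R)
    (B : set 'rV[R]_m) (w : 'rV[R]_m) : \bar R :=
  ereal_sup [set saddle Phi f h (xpart e w) (ypart e z)
                 - saddle Phi f h (xpart e z) (ypart e w) | z in B].

End Minimax.

(* Main.v *)
Require Import Defs.
From mathcomp Require Import all_boot all_order all_algebra.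
From mathcomp Require Import all_classical all_reals all_analysis.
From mathcomp Require Import ring lra.
Import Order.TTheory GRing.Theory Num.Theory.
Import numFieldNormedType.Exports.
Local Open Scope classical_set_scope.
Local Open Scope ring_scope.

(* Optimality of w_k in the prox problem and the four-point identity bound
   2 alpha (r(w_k) - r(u) + <F(w_k), w_k - u>) by
   |z_k - u|^2 - |z_(k+1) - u|^2 + |z_(k+1) - w_k|^2 - |z_k - w_k|^2.
   With q_k the point where F is evaluated first, both choices of step size make
   the potential |z_k - u|^2 + |z_k - q_k|^2 absorb the last two terms, and it
   starts at |z_0 - u|^2. Summing, then applying Jensen's inequality to a convex
   function G with G(w_k) <= r(w_k) - r(u) + <F(w_k), w_k - u>, bounds G at the
   average. Monotonicity of F, resp. the gradient inequalities for Phi, show that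
   both integrands of the gap functions are such a G. *)

(** * Inner product, Euclidean norm and its comparison with the sup norm *)

Section Dot.
Context {R : realType} {m : nat}.
Implicit Types (u v w : 'rV[R]_m) (a : R).

Lemma dotvE u v : dotv u v = \sum_i u 0 i * v 0 i.
Proof. by rewrite /dotv mxE; apply: eq_bigr => i _; rewrite mxE. Qed.

Lemma dotvC u v : dotv u v = dotv v u.
Proof. by rewrite !dotvE; apply: eq_bigr => i _; rewrite mulrC. Qed.

Lemma dotvDl u v w : dotv (u + v) w = dotv u w + dotv v w.
Proof. by rewrite /dotv mulmxDl mxE. Qed.

Lemma dotvZl a u w : dotv (a *: u) w = a * dotv u w.
Proof. by rewrite /dotv -scalemxAl mxE. Qed.

Lemma dotvNl u w : dotv (- u) w = - dotv u w.
Proof. by rewrite -scaleN1r dotvZl mulN1r. Qed.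

Lemma dotv0l u : dotv 0 u = 0.
Proof. by rewrite -(scale0r 0) dotvZl mul0r. Qed.

Lemma dotvDr u v w : dotv w (u + v) = dotv w u + dotv w v.
Proof. by rewrite dotvC dotvDl !(dotvC w). Qed.

Lemma dotvZr a u w : dotv w (a *: u) = a * dotv w u.
Proof. by rewrite dotvC dotvZl (dotvC w). Qed.

Lemma dotvNr u w : dotv w (- u) = - dotv w u.
Proof. by rewrite dotvC dotvNl (dotvC w). Qed.

Definition dotv_simpl := (dotvDl, dotvDr, dotvNl, dotvNr, dotvZl, dotvZr).

Lemma dotvv_ge0 u : 0 <= dotv u u.
Proof. by rewrite dotvE sumr_ge0// => i _; rewrite -expr2 sqr_ge0. Qed.

Lemma enorm_ge0 u : 0 <= enorm u.
Proof. exact: sqrtr_ge0. Qed.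

Lemma sqr_enorm u : enorm u ^+ 2 = dotv u u.
Proof. by rewrite sqr_sqrtr// dotvv_ge0. Qed.

Lemma norm_coord_le u i : `|u 0 i| <= `|u|.
Proof.
rewrite [leRHS]/Num.norm/= mx_normrE.
exact: (le_bigmax _ (fun i : 'I_1 * 'I_m => `|u i.1 i.2|) (0, i)).
Qed.

Lemma normr_le_enorm u : `|u| <= enorm u.
Proof.
rewrite /Num.norm/= mx_normrE; apply: bigmax_le; first exact: enorm_ge0.
move=> [i j] _ /=; rewrite ord1 -sqrtr_sqr ler_wsqrtr// dotvE (bigD1 j)//=.
by rewrite -expr2 lerDl sumr_ge0// => k _; rewrite -expr2 sqr_ge0.
Qed.

Lemma dotvv_le_norm u : dotv u u <= m%:R * `|u| ^+ 2.
Proof.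
rewrite dotvE; apply: (@le_trans _ _ (\sum_(i < m) `|u| ^+ 2)).
  by apply: ler_sum => i _; rewrite -expr2 -real_normK ?num_real// lerXn2r
    ?nnegrE// norm_coord_le.
by rewrite sumr_const card_ord mulr_natl.
Qed.

Lemma enorm_le_norm u : enorm u <= Num.sqrt m%:R * `|u|.
Proof.
rewrite -[X in _ * X](ger0_norm (normr_ge0 u)) -sqrtr_sqr -sqrtrM ?ler0n//.
by rewrite ler_wsqrtr// dotvv_le_norm.
Qed.

Lemma dotvv_continuous w : continuous (fun u : 'rV[R]_m => dotv (u - w) (u - w)).
Proof.
have -> : (fun u => dotv (u - w) (u - w)) =
    (fun u => \sum_i (u - w) 0 i * (u - w) 0 i).
  by apply/funext => u; rewrite dotvE.
apply: (@continuous_big R _ +%R); first exact: add_continuous.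
move=> i _ u.
have c : (x - w) 0 i @[x --> u] --> (u - w) 0 i.
  under eq_fun do rewrite !mxE.
  by rewrite !mxE; apply: (cvgB (@coord_continuous R 1 m 0 i u)); exact: cvg_cst.
exact: (cvgM c c).
Qed.

Lemma enorm_diam (B : set 'rV[R]_m) u v : compact B -> B u -> B v ->
  enorm (v - u) <= diam B.
Proof.
move=> /compact_bounded[M [_ MB]] Bu Bv; apply: sup_upper_bound; last first.
  by exists (u, v).
split; first by exists (enorm (v - u)); exists (u, v).
(* Boundedness gives a norm bound for each number above [M], hence [M + 1]. The triangle inequality
   doubles it, and the factor sqrt m passes from the sup norm to the Euclidean one. *)
exists (Num.sqrt m%:R * (2 * (M + 1))) => _ [[x y]] /= [Bx By] <-.
apply: (le_trans (enorm_le_norm _)); rewrite ler_wpM2l// ?sqrtr_ge0//.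
have M1 : M < M + 1 by rewrite ltrDl.
have := MB _ M1 _ Bx; have := MB _ M1 _ By => /= ? ?.
by rewrite (le_trans (ler_normB _ _))// mulr_natl mulr2n lerD.
Qed.

End Dot.

(** * Lower semicontinuity, existence of proximal points and their optimality condition *)

Section Ext.
Context {R : realType}.
Local Open Scope ereal_scope.

(** The sublevel sets of [g] at the values [g x], cut down to [K], are nested and so form a filter
    base; compactness gives a cluster point [p]. If some [g x] were below [g p], lower
    semicontinuity would give a neighbourhood of [p] missing the sublevel set of [x]. *)
Lemma lsc_compact_argmin {T : topologicalType} (g : T -> \bar R) (K : set T) :
  lower_semicontinuous g -> compact K -> K !=set0 ->
  exists2 p, K p & forall x, K x -> g p <= g x.
Proof.
move=> lscg cK [x0 Kx0].
pose sub x := K `&` [set y | g y <= g x].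
have FF : ProperFilter (filter_from K sub).
  apply: filter_from_proper; last by move=> x Kx; exists x; split => /=.
  apply: filter_from_filter; first by exists x0.
  move=> x y Kx Ky; have [xy|/ltW yx] := leP (g x) (g y).
    by exists x => // t [Kt /= tx]; do 2!split => //=; exact: le_trans xy.
  by exists y => // t [Kt /= tx]; do 2!split => //=; exact: le_trans yx.
have [|p [Kp clp]] := cK _ FF; first by exists x0 => // t [].
exists p => // x Kx; rewrite leNgt; apply/negP => gxp.
(* Lower semicontinuity is tested against real thresholds, so a real number has to separate the two
   extended values. *)
have [a gxa agp] : exists2 a : R, g x <= a%:E & a%:E < g p.
  case: (g x) gxp => [a| |]//; first by exists a.
    by rewrite ltNge leey.
  case: (g p) => [b| |]// _; first by exists (b - 1)%R; rewrite ?leNye ?lte_fin//; lra.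
  by exists 0%R; rewrite ?leNye ?ltry.
have [V Vp gV] := lscg _ _ agp.
have [|y [[_ /= gyx] /gV]] := clp (sub x) V _ Vp; first by exists x.
by rewrite ltNge (le_trans gyx).
Qed.

Lemma lscD_continuous {T : topologicalType} (g : T -> \bar R) (c : T -> R) :
  lower_semicontinuous g -> (forall x, g x != -oo) -> continuous c ->
  lower_semicontinuous (fun x => g x + (c x)%:E).
Proof.
move=> lscg gN cc x a agc.
(* The threshold [a] is split into [b], which stays below [g] near [x], and [a - b], which stays
   below [c] near [x]. *)
have [b ab bg] : exists2 b : R, (a - c x < b)%R & b%:E < g x.
  move: agc (gN x); case: (g x) => [s| |]//.
    rewrite -EFinD lte_fin => h _; exists (((a - c x) + s) / 2)%R; last rewrite lte_fin; lra.
  by move=> _ _; exists (a - c x + 1)%R; rewrite ?ltry//; lra.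
have [V Vx gV] := lscg _ _ bg.
exists (V `&` [set y | (a - b < c y)%R]) => /=.
  apply: filterI => //; apply: (cc x [set r | (a - b < r)%R]).
  by apply: open_nbhs_nbhs; split => /=; [exact: open_gt | lra].
move=> y [Vy /= h]; have := gV _ Vy.
case: (g y) => [s| |]; last by rewrite ltNge leNye.
  2: by move=> _; rewrite addye // ltry.
by rewrite -EFinD !lte_fin => ?; lra.
Qed.

Lemma closed_ball_compact {m : nat} (x : 'rV[R]_m) (e : R) : (0 < e)%R ->
  compact (closed_ball x e).
Proof.
move=> e0; apply: bounded_closed_compact; last exact: closed_ball_closed.
exists (`|x| + e)%R; split; first exact: num_real.
move=> M eM y; rewrite closed_ballE// /closed_ball_ /= => xy.
rewrite (le_trans _ (ltW eM))// -[y](subKr x) (le_trans (ler_normB _ _))//.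
by rewrite lerD2l.
Qed.

(* A minimum b of r on the unit ball around x0 propagates along rays from x0. *)
Lemma convex_lsc_linear_minorant {m : nat} (r : 'rV[R]_m -> \bar R) x0 a :
  (forall x, r x != -oo) -> econvex r -> lower_semicontinuous r ->
  r x0 = a%:E ->
  exists2 C : R, (0 <= C)%R & forall x, (- (C * (1 + `|x - x0|)))%:E <= r x.
Proof.
move=> rN cr lr ra.
have [|p _ pmin] := lsc_compact_argmin _ _ lr (closed_ball_compact x0 _ ltr01).
  by exists x0; exact: closed_ballxx.
have [b bmin] : exists b : R, forall y, closed_ball x0 1%R y -> b%:E <= r y.
  case E : (r p) (rN p) pmin => [b| |]// _ pmin; first by exists b.
  by exists 0%R => y /pmin; rewrite leye_eq => /eqP ->; rewrite leey.
exists (`|a| + `|b|)%R; first by rewrite addr_ge0.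
move=> x; set N := `|x - x0|%R.
have N0 : (0 <= N)%R by exact: normr_ge0.
have := ler_norm (- b); rewrite normrN => hb; have ha := ler_norm a.
have a0 := normr_ge0 a; have b0 := normr_ge0 b.
have [N1|N1] := leP N 1%R.
  apply: (le_trans _ (bmin x _)).
    by rewrite lee_fin; nra.
  by rewrite closed_ballE// /closed_ball_ /= distrC.
have Ni : (0 < N)%R by exact: lt_trans N1.
have Nt : (0 <= N^-1 <= 1)%R by rewrite invr_ge0 N0 invf_le1// ltW.
have := cr x x0 _ Nt; rewrite ra.
(* This is the point of the segment from [x0] to [x] at distance 1 from [x0]. Convexity there yields
   r(x) >= N b - (N - 1) a. *)
have /bmin by1 : closed_ball x0 1%R (N^-1 *: x + (1 - N^-1) *: x0)%R.
  rewrite closed_ballE// /closed_ball_ /=.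
  have -> : (x0 - (N^-1 *: x + (1 - N^-1) *: x0) = N^-1 *: (x0 - x))%R.
    by apply/rowP => i; rewrite !mxE; ring.
  rewrite normrZ gtr0_norm ?invr_gt0// distrC.
  by rewrite mulVf// gt_eqF.
move=> /(le_trans by1).
case: (r x) (rN x) => [s| |]// _; last by rewrite leey.
rewrite -!EFinM -EFinD !lee_fin => H.
have := ler_wpM2l N0 H.
have -> : (N * (N^-1 * s + (1 - N^-1) * a) = s + (N - 1) * a)%R.
  by field; rewrite gt_eqF.
by nra.
Qed.

(** The quadratic term outgrows the linear minorant of [r], so outside a large ball the objective is
    at least its value at [x0]. A minimizer over that compact ball is therefore global. *)
Lemma prox_argmin {m : nat} (lambda : R) (r : 'rV[R]_m -> \bar R) w :
  (0 < lambda)%R -> proper_convex_lsc r ->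
  argmin (fun w' => r w' + ((2 * lambda)^-1 * enorm (w' - w) ^+ 2)%:E)
    (prox lambda r w).
Proof.
move=> l0 [[rN [x0 rx0]] cr lr]; apply: xgetPex.
set c := ((2 * lambda)^-1)%R.
have c0 : (0 < c)%R by rewrite invr_gt0 mulr_gt0.
pose g x := r x + (c * dotv (x - w) (x - w))%:E.
have -> : (fun x => r x + (c * enorm (x - w) ^+ 2)%:E) = g.
  by apply/funext => x; rewrite sqr_enorm.
have lg : lower_semicontinuous g.
  apply: lscD_continuous => // x.
  exact: (cvgM (cvg_cst _) (dotvv_continuous w x)).
case ra : (r x0) rx0 (rN x0) => [a| |]// _ _.
have [C C0 minor] := convex_lsc_linear_minorant _ _ _ rN cr lr ra.
pose M := `|w - x0|%R; have M0 : (0 <= M)%R by exact: normr_ge0.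
pose g0 := (a + c * dotv (x0 - w) (x0 - w))%R.
pose A := (g0 + C * (1 + M))%R.
(* The summand [M + 1] puts [x0] in the ball and makes N = |x - w| at least 1 outside it. The rest
   gives c N >= C + |A| + c there, hence c N^2 - C N >= |A|, which covers [g0] and the constant part
   of the minorant. *)
pose rho := (M + 1 + (C + `|A|) / c)%R.
have rhoM : (M + 1 <= rho)%R by rewrite lerDl divr_ge0 ?addr_ge0 ?normr_ge0// ltW.
have rho0 : (0 < rho)%R by lra.
have cK := closed_ball_compact w _ rho0.
have [|p Kp pmin] := lsc_compact_argmin _ _ lg cK.
  by exists w; exact: closed_ballxx.
exists p => x; have [/pmin//|] := pselect (closed_ball w rho x).
rewrite closed_ballE// /closed_ball_ /= => /negP; rewrite -ltNge distrC => Nx.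
have : g p <= g x0.
  apply: pmin; rewrite closed_ballE// /closed_ball_ /= -/M; lra.
move=> /le_trans; apply; rewrite /g ra -EFinD -/g0.
apply: (@le_trans _ _ (- (C * (1 + `|x - x0|)) + c * dotv (x - w) (x - w))%:E);
  last by rewrite EFinD leeD2r.
rewrite lee_fin.
have t1 : (`|x - x0| <= `|x - w| + M)%R by rewrite /M ler_distD.
have t2 : (`|x - w| ^+ 2 <= dotv (x - w) (x - w))%R.
  by rewrite -sqr_enorm lerXn2r ?nnegrE ?enorm_ge0// normr_le_enorm.
move: t1 t2 Nx; move: `|x - x0|%R (`|x - w|)%R (dotv (x - w) _) => T N Q t1 t2 Nx.
have N1 : (1 <= N)%R by lra.
have cN : (c + C + `|A| < c * N)%R.
  have := Nx; rewrite -(ltr_pM2l c0) => /le_lt_trans; apply.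
  have -> : (c * rho = c * (M + 1) + C + `|A|)%R by rewrite /rho; field; rewrite gt_eqF.
  by nra.
have Age := ler_norm A; have A0 := normr_ge0 A.
have h1 : (`|A| <= N * (c * N - C))%R by nra.
have h2 : (c * N ^+ 2 <= c * Q)%R by rewrite ler_pM2l.
have h3 : (C * (1 + T) <= C * (1 + N + M))%R by rewrite ler_wpM2l//; lra.
rewrite /A in Age h1 *. nra.
Qed.

Lemma prox_fin_num {m : nat} (lambda : R) (r : 'rV[R]_m -> \bar R) w :
  (0 < lambda)%R -> proper_convex_lsc r -> r (prox lambda r w) \is a fin_num.
Proof.
move=> l0 rp; have := prox_argmin _ _ w l0 rp.
have [[rN [x0 rx0]] _ _] := rp => /(_ x0).
case: (r x0) rx0 (rN x0) => [a| |]// _ _.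
by case: (r (prox _ _ _)) (rN (prox lambda r w)).
Qed.

(* First-order optimality, from comparing p with the points p + t (u - p). *)
Lemma prox_variational {m : nat} (lambda : R) (r : 'rV[R]_m -> \bar R) w p u :
  (0 < lambda)%R -> proper_convex_lsc r -> p = prox lambda r w ->
  r p + (lambda^-1 * dotv (w - p) (u - p))%:E <= r u.
Proof.
move=> l0 rp pE; have := prox_argmin _ _ w l0 rp; have := prox_fin_num _ _ w l0 rp.
rewrite -pE => pfin pmin; have [[rN _] cr _] := rp.
rewrite -(fineK pfin) -EFinD.
case ru : (r u) (rN u) => [s| |]// _; last by rewrite leey.
rewrite lee_fin; set rp' := fine _.
set X := dotv _ _; set Y := dotv (u - p) (u - p).
have step (t : R) : (0 <= t <= 1)%R -> (0 <= t * (s - rp' - lambda^-1 * X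
    + t * ((2 * lambda)^-1 * Y)))%R.
  move=> t01; have := pmin (t *: u + (1 - t) *: p)%R.
  rewrite !sqr_enorm.
  have := cr u p t t01; rewrite ru -(fineK pfin) -/rp' -!EFinM -EFinD => h1 h2.
  have := le_trans h2 (leeD2r _ h1); rewrite -!EFinD lee_fin -subr_ge0.
  move=> /le_trans; apply; rewrite le_eqVlt; apply/orP; left; apply/eqP.
  rewrite /X /Y !dotv_simpl (dotvC p w) (dotvC u w) (dotvC p u).
  by field; rewrite gt_eqF.
have Y0 : (0 <= (2 * lambda)^-1 * Y)%R.
  by rewrite mulr_ge0 ?dotvv_ge0// invr_ge0 mulr_ge0// ltW.
rewrite leNgt; apply/negP => neg.
move: step Y0; move: (_ * Y)%R => Z step Z0.
set e := (rp' + lambda^-1 * X - s)%R; have e0 : (0 < e)%R by rewrite /e; lra.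
(* If the inequality failed by [e], minimality would give 0 <= - e + t Z for each t in (0, 1]. This
   [t] makes t Z at most e / 2; the [e] in the denominator keeps it well defined and at most 1 even
   when Z = 0. *)
pose t := (e / (e + Z + Z))%R.
have D0 : (0 < e + Z + Z)%R by lra.
have t0 : (0 < t)%R by rewrite divr_gt0.
have t1 : (t <= 1)%R by rewrite ler_pdivrMr//; lra.
have := step t; rewrite t1 ltW// => /(_ isT); rewrite pmulr_rge0//.
have -> : (s - rp' - lambda^-1 * X = - e)%R by rewrite /e; ring.
have : (t * (Z + Z) <= e)%R by rewrite /t mulrAC ler_pdivrMr//; nra.
have : (0 <= t * Z)%R by rewrite mulr_ge0 // ltW.
rewrite mulrDr; lra.
Qed.

End Ext.

(** * Jensen's inequality, gradient inequalities and partial gradients *)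

Section Convexity.
Context {R : realType}.

Lemma econvex_EFin {m : nat} (g : 'rV[R]_m -> R) :
  (forall x y t, 0 <= t <= 1 ->
     g (t *: x + (1 - t) *: y) <= t * g x + (1 - t) * g y) ->
  econvex (fun x => (g x)%:E).
Proof. by move=> gc x y t t01; rewrite -!EFinM -EFinD lee_fin gc. Qed.

Lemma econvexD {m : nat} (f g : 'rV[R]_m -> \bar R) :
  (forall x, f x != -oo%E) -> (forall x, g x != -oo%E) ->
  econvex f -> econvex g -> econvex (fun x => f x + g x)%E.
Proof.
move=> fN gN fc gc x y t t01.
have fgD z : adde_def (f z) (g z).
  by move: (fN z) (gN z); case: (f z) => [?| |]; case: (g z).
rewrite !muleDr// addeACA.
by apply: leeD; [exact: fc | exact: gc].
Qed.

(** Induction on the number of points: the mean of n + 1 points combines the mean of the first n,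
    with weight n / (n + 1), and the last point. The real bounds [a k] keep the right-hand side
    finite. *)
Lemma econvex_mean {m : nat} (g : 'rV[R]_m -> \bar R) (w : nat -> 'rV[R]_m)
    (a : nat -> R) (K : nat) :
  econvex g -> (0 < K)%N -> (forall k, (g (w k) <= (a k)%:E)%E) ->
  (g (K%:R^-1 *: \sum_(k < K) w k) <= (K%:R^-1 * \sum_(k < K) a k)%:E)%E.
Proof.
case: K => // K gc _ ga; elim: K => [|K IH].
  by rewrite !big_ord1 invr1 scale1r mul1r.
rewrite !(big_ord_recr K.+1)/=.
have K1 : K.+1%:R != 0 :> R by rewrite pnatr_eq0.
have K2 : K.+1%:R + 1 != 0 :> R by rewrite natr1 pnatr_eq0.
rewrite -(@natr1 _ K.+1); set n := K.+1%:R in K1 K2 IH *.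
pose t : R := n / (n + 1).
have tC : 1 - t = (n + 1)^-1 by rewrite /t; field.
have tE : t * n^-1 = (n + 1)^-1 by rewrite /t mulrAC divff ?mul1r.
have t01 : 0 <= t <= 1.
  have n0 : 0 <= n by rewrite ler0n.
  by rewrite divr_ge0 ?addr_ge0//= ler_pdivrMr ?ltr_wpDl// mul1r lerDl.
rewrite scalerDr mulrDr -{1 3}tE -tC -scalerA -mulrA.
apply: (le_trans (gc _ _ _ t01)); rewrite [leRHS]EFinD.
have [? ?] := andP t01.
by apply: leeD; rewrite [leRHS]EFinM; apply: lee_wpmul2l => //; rewrite lee_fin// subr_ge0.
Qed.

(** Convexity bounds the difference quotient by g(y) - g(x) for every t in (0, 1], and the bound
    survives the limit from the right. *)
Lemma convex_derive_le {m : nat} (g : 'rV[R]_m -> R) x y :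
  (forall x y t, 0 <= t <= 1 ->
     g (t *: x + (1 - t) *: y) <= t * g x + (1 - t) * g y) ->
  derivable (g : _ -> R^o) x (y - x) ->
  'D_(y - x) (g : _ -> R^o) x <= g y - g x.
Proof.
move=> gc /cvg_dnbhs_at_right dg.
apply: (cvgr_to_le dg).
near=> t.
have t0 : 0 < t by near: t; exact: nbhs_right_gt.
have t1 : t <= 1 by near: t; exact: nbhs_right_le.
rewrite /GRing.scale/= mulrC ler_pdivrMr//.
have -> : t *: (y - x) + x = t *: y + (1 - t) *: x.
  by apply/rowP => i; rewrite !mxE; ring.
have := gc y x t; rewrite ltW// t1 => /(_ isT); lra.
Unshelve. all: by end_near. Qed.

Lemma convex_functionE {m : nat} (g : 'rV[R]_m -> R) :
  convex_function [set: 'rV[R]_m] g ->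
  forall x y t, 0 <= t <= 1 ->
     g (t *: x + (1 - t) *: y) <= t * g x + (1 - t) * g y.
Proof.
move=> gc x y t /andP[t0 t1].
by have := gc (Itv01 t0 t1) x y; rewrite !inE => /(_ Logic.I Logic.I).
Qed.

End Convexity.

(** Directional derivatives alone need not be linear in the direction. Here [g] is [J] along an
    affine map, so the difference quotients coincide and linearity comes from the differential of
    [J]. This is applied to the partial functions of [joint Phi]. *)
Lemma grad_affine {R : realType} {p N : nat} (g : 'rV[R]_p -> R)
    (J : 'rV[R]_N -> R) (l : {linear 'rV[R]_p -> 'rV[R]_N}) x q :
  differentiable (J : _ -> R^o) q -> (forall v, g (v + x) = J (l v + q)) ->
  forall v, derivable (g : _ -> R^o) x v /\
    'D_v (g : _ -> R^o) x = dotv (grad g x) v.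
Proof.
move=> Jq gJ.
have quotE v : (fun t : R => t^-1 *: (((g : _ -> R^o) \o shift x) (t *: v) - g x)) =
    (fun t : R => t^-1 *: (((J : _ -> R^o) \o shift q) (t *: l v) - J q)).
  apply/funext => t /=; rewrite gJ linearZ.
  by have := gJ 0; rewrite linear0 !add0r => ->.
have gD v : 'D_v (g : _ -> R^o) x = 'd (J : _ -> R^o) q (l v).
  by rewrite -deriveE// /derive quotE.
move=> v; split.
  by rewrite /derivable quotE; exact: diff_derivable.
rewrite gD {1}(row_sum_delta v) !linear_sum dotvE; apply: eq_bigr => i _.
by rewrite !linearZ mxE gD mulrC.
Qed.

Section JointGradient.
Context {R : realType} {d n : nat} (Phi : 'rV[R]_d -> 'rV[R]_n -> R).
Context (Phi_diff : forall p, differentiable (joint Phi : _ -> R^o) p).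

Lemma grad_fst x y v :
  derivable ((fun x => Phi x y) : _ -> R^o) x v /\
  'D_v ((fun x => Phi x y) : _ -> R^o) x = dotv (grad (fun x => Phi x y) x) v.
Proof.
apply: (grad_affine (fun x => Phi x y) _ (mulmxr (row_mx 1%:M 0)) _ _
  (Phi_diff (row_mx x y))).
move=> u; rewrite /= mul_mx_row mulmx1 mulmx0 add_row_mx add0r.
by rewrite /joint row_mxKl row_mxKr.
Qed.

Lemma grad_snd x y v :
  derivable ((fun y => Phi x y) : _ -> R^o) y v /\
  'D_v ((fun y => Phi x y) : _ -> R^o) y = dotv (grad (fun y => Phi x y) y) v.
Proof.
apply: (grad_affine (fun y => Phi x y) _ (mulmxr (row_mx 0 1%:M)) _ _
  (Phi_diff (row_mx x y))).
move=> u; rewrite /= mul_mx_row mulmx1 mulmx0 add_row_mx add0r.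
by rewrite /joint row_mxKl row_mxKr.
Qed.

End JointGradient.

(** * The descent inequality and the bound for averaged iterates *)

Section Descent.
Context {R : realType} {m : nat} (L alpha : R) (F : 'rV[R]_m -> 'rV[R]_m)
  (r : 'rV[R]_m -> \bar R) (w z q : nat -> 'rV[R]_m).
Context (L_gt0 : 0 < L) (F_lipschitz : elipschitz L F)
  (r_pcl : proper_convex_lsc r) (alpha_gt0 : 0 < alpha) (q0 : q 0%N = z 0%N)
  (w_step : forall k, w k = prox alpha r (z k - alpha *: F (q k)))
  (z_step : forall k, z k.+1 = w k + alpha *: (F (q k) - F (w k)))
  (choice : (forall k, q k = z k) /\ alpha <= 1 / L
         \/ (forall k, q k.+1 = w k) /\ alpha <= 1 / (2 * L)).

(** With [x], [y] equal to q_k, w_k this controls the correction z_(k+1) - w_k. The first step-size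
    choice uses c = 1, the second c = 1/2. *)
Lemma correction_le (c : R) x y : 0 <= c -> alpha <= c / L ->
  dotv (alpha *: (F x - F y)) (alpha *: (F x - F y)) <=
    c ^+ 2 * dotv (x - y) (x - y).
Proof.
move=> c0; rewrite ler_pdivlMr// => aLc.
rewrite -!sqr_enorm -exprMn lerXn2r ?nnegrE ?mulr_ge0 ?enorm_ge0//.
have -> : enorm (alpha *: (F x - F y)) = alpha * enorm (F x - F y).
  rewrite /enorm dotvZl dotvZr mulrA sqrtrM ?mulr_ge0 ?ltW// -expr2 sqrtr_sqr.
  by rewrite gtr0_norm.
apply: le_trans (_ : alpha * (L * enorm (x - y)) <= _).
  by rewrite ler_pM2l.
by rewrite mulrA ler_wpM2r ?enorm_ge0.
Qed.

(* In the second case |q - w|^2 <= 2 |q - z|^2 + 2 |z - w|^2 and alpha L <= 1/2. *)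
Lemma potential_step k :
  dotv (z k.+1 - w k) (z k.+1 - w k) + dotv (z k.+1 - q k.+1) (z k.+1 - q k.+1)
    <= dotv (z k - w k) (z k - w k) + dotv (z k - q k) (z k - q k).
Proof.
have zw : z k.+1 - w k = alpha *: (F (q k) - F (w k)).
  by rewrite z_step addrAC subrr add0r.
have [[qz aL]|[qw aL]] := choice.
  have := correction_le _ (q k) (w k) ler01 aL.
  by rewrite zw expr1n mul1r !qz !subrr !dotv0l !addr0.
have aL2 : alpha <= 2^-1 / L by rewrite -invfM -div1r.
have h2 : 0 <= 2^-1 :> R by rewrite invr_ge0.
(* Since q_(k+1) = w_k, both terms on the left are the same squared correction, each at most |q_k -
   w_k|^2 / 4. *)
rewrite qw zw; have := correction_le _ (q k) (w k) h2 aL2.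
have := dotvv_ge0 ((z k - w k) + (z k - q k)).
have -> : q k - w k = (z k - w k) - (z k - q k).
  by apply/rowP => i; rewrite !mxE; ring.
move: (z k - w k) (z k - q k) => X Y.
rewrite !(dotvDl, dotvDr, dotvNl, dotvNr) (dotvC Y X); lra.
Qed.

Lemma descent_step k u a : r u = a%:E ->
  fine (r (w k)) + dotv (F (w k)) (w k - u) - a <= (2 * alpha)^-1 *
    (dotv (z k - u) (z k - u) + dotv (z k - q k) (z k - q k)
    - (dotv (z k.+1 - u) (z k.+1 - u)
       + dotv (z k.+1 - q k.+1) (z k.+1 - q k.+1))).
Proof.
move=> ru; have := prox_variational _ _ _ _ u alpha_gt0 r_pcl (w_step k).
have := prox_fin_num _ _ (z k - alpha *: F (q k)) alpha_gt0 r_pcl.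
rewrite -w_step => /fineK <-; rewrite ru -EFinD lee_fin.
move: (potential_step k); rewrite [leLHS]addrC -lerBrDr => P V.
rewrite -(ler_pM2l alpha_gt0) mulrA.
have -> : alpha * (2 * alpha)^-1 = 2^-1 by field; rewrite gt_eqF.
move: V; rewrite -(ler_pM2l alpha_gt0) mulrDr mulrA divff ?gt_eqF// mul1r => V.
(* By the update rule, z_k - alpha F(q_k) - w_k = z_k - z_(k+1) - alpha F(w_k), so F(q_k) disappears
   from the optimality condition. *)
have E : dotv (z k - alpha *: F (q k) - w k) (u - w k) =
    - alpha * dotv (F (w k)) (u - w k) + dotv (z k - z k.+1) (u - w k).
  rewrite z_step !dotv_simpl; ring.
have T : 2 * dotv (z k - z k.+1) (u - w k) =
    dotv (z k.+1 - u) (z k.+1 - u) - dotv (z k - u) (z k - u)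
    + dotv (z k - w k) (z k - w k) - dotv (z k.+1 - w k) (z k.+1 - w k).
  rewrite !dotv_simpl !(dotvC u) !(dotvC (w k)); ring.
move: V; rewrite E -(opprB u (w k)) dotvNr; nra.
Qed.

(** The function [G] is left abstract so that one telescoping argument serves both gap functions. *)
Lemma averaged_gap_le (G : 'rV[R]_m -> \bar R) u a K :
  (0 < K)%N -> r u = a%:E -> econvex G ->
  (forall k, G (w k) <= (fine (r (w k)) + dotv (F (w k)) (w k - u) - a)%:E)%E ->
  (G (K%:R^-1 *: \sum_(k < K) w k) <=
    (enorm (z 0%N - u) ^+ 2 / (2 * alpha * K%:R))%:E)%E.
Proof.
move=> K0 ru Gc Gw; apply: (le_trans (econvex_mean _ _ _ _ Gc K0 Gw)).
pose V k := dotv (z k - u) (z k - u) + dotv (z k - q k) (z k - q k).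
rewrite lee_fin invfM mulrA mulrC ler_wpM2r ?invr_ge0// sqr_enorm.
apply: (@le_trans _ _ (\sum_(k < K) (2 * alpha)^-1 * (V k - V k.+1))).
  by apply: ler_sum => k _; exact: descent_step.
have -> : \sum_(k < K) (2 * alpha)^-1 * (V k - V k.+1) =
    (2 * alpha)^-1 * (V 0%N - V K).
  rewrite -mulr_sumr; congr (_ * _); elim: (K) => [|n IH].
    by rewrite big_ord0 subrr.
  by rewrite big_ord_recr/= IH; ring.
rewrite mulrC ler_wpM2r ?invr_ge0 ?mulr_ge0 ?(ltW alpha_gt0)//.
(* The initial potential is |z_0 - u|^2 because q_0 = z_0, and the final one is dropped as
   nonnegative. *)
rewrite {1}/V q0 subrr dotv0l addr0 gerBl.
by rewrite addr_ge0// dotvv_ge0.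
Qed.

End Descent.

(** * Block decomposition and the saddle inequality *)

Section Blocks.
Context {R : realType} {m d n : nat} (e : m = (d + n)%N).
Implicit Types u v : 'rV[R]_m.

Lemma xpartD u v : xpart e (u + v) = xpart e u + xpart e v.
Proof. by subst m; rewrite /xpart !castmx_id linearD. Qed.

Lemma xpartZ a u : xpart e (a *: u) = a *: xpart e u.
Proof. by subst m; rewrite /xpart !castmx_id linearZ. Qed.

Lemma ypartD u v : ypart e (u + v) = ypart e u + ypart e v.
Proof. by subst m; rewrite /ypart !castmx_id linearD. Qed.

Lemma ypartZ a u : ypart e (a *: u) = a *: ypart e u.
Proof. by subst m; rewrite /ypart !castmx_id linearZ. Qed.

Lemma dotv_parts u v :
  dotv u v = dotv (xpart e u) (xpart e v) + dotv (ypart e u) (ypart e v).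
Proof.
subst m; rewrite /xpart /ypart !castmx_id.
rewrite -{1}(hsubmxK u) -{1}(hsubmxK v) {1}/dotv tr_row_mx mul_row_col.
by rewrite mxE.
Qed.

Lemma econvex_xpart (f : 'rV[R]_d -> \bar R) :
  econvex f -> econvex (fun w => f (xpart e w)).
Proof. by move=> fc x y t t01; rewrite xpartD !xpartZ fc. Qed.

Lemma econvex_ypart (f : 'rV[R]_n -> \bar R) :
  econvex f -> econvex (fun w => f (ypart e w)).
Proof. by move=> fc x y t t01; rewrite ypartD !ypartZ fc. Qed.

End Blocks.

(** Add the gradient inequalities at [w] for the convex functions Phi(., y_w) and - Phi(x_w, .), in
    the directions of the blocks of u - w; the value Phi(x_w, y_w) cancels. *)
Lemma saddle_gap_le {R : realType} {m d n : nat} (L : R)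
    (F : 'rV[R]_m -> 'rV[R]_m) r (e : m = (d + n)%N) Phi f h (w u : 'rV[R]_m) :
  from_minimax L F r e Phi f h ->
  Phi (xpart e w) (ypart e u) - Phi (xpart e u) (ypart e w)
    <= dotv (F w) (w - u).
Proof.
case=> Phic Phicc Phid _ _ _ FE _.
have [Fx Fy] := FE w.
rewrite -(scaleN1r u) (dotv_parts e) Fx Fy xpartD xpartZ ypartD ypartZ !scaleN1r.
have [dx Dx] := grad_fst Phi Phid (xpart e w) (ypart e w) (xpart e u - xpart e w).
have [dy Dy] := grad_snd Phi Phid (xpart e w) (ypart e w) (ypart e u - ypart e w).
have := convex_derive_le _ _ _ (convex_functionE _ (Phic _)) dx; rewrite Dx.
have dNy : derivable ((fun y => - Phi (xpart e w) y) : _ -> R^o) (ypart e w)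
    (ypart e u - ypart e w) by exact: derivableN.
have := convex_derive_le _ _ _ (convex_functionE _ (Phicc _)) dNy.
rewrite deriveN// Dy !dotv_simpl; lra.
Qed.

(** * The bounds for the two gap functions *)

Theorem theorem3p1 (R : realType) (m : nat) (L alpha : R)
    (F : 'rV[R]_m -> 'rV[R]_m) (r : 'rV[R]_m -> \bar R)
    (B : set 'rV[R]_m) (z0 : 'rV[R]_m) (w z q : nat -> 'rV[R]_m)
    (L_gt0 : 0 < L) (F_monotone : monotone_op F) (F_lipschitz : elipschitz L F)
    (r_pcl : proper_convex_lsc r)
    (B_compact : compact B) (z0_in : B z0)
    (alpha_gt0 : 0 < alpha) (z_init : z 0%N = z0)
    (w_step : forall k, w k = prox alpha r (z k - alpha *: F (q k)))
    (z_step : forall k, z k.+1 = w k + alpha *: (F (q k) - F (w k)))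
    (choice : (forall k, q k = z k) /\ alpha <= 1 / L
           \/ (forall k, q k = if k is k'.+1 then w k' else z0)
              /\ alpha <= 1 / (2 * L)) :
  forall K : nat, (1 <= K)%N ->
    let wbar := K%:R^-1 *: (\sum_(k < K) w k) in
    let bound := (diam B ^+ 2 / (2 * alpha * K%:R))%:E in
    (gap_vi F r B wbar <= bound)%E /\
    (forall (d n : nat) (e : m = (d + n)%N) (Phi : 'rV[R]_d -> 'rV[R]_n -> R)
       (f : 'rV[R]_d -> \bar R) (h : 'rV[R]_n -> \bar R),
       from_minimax L F r e Phi f h ->
       (gap_minimax e Phi f h B wbar <= bound)%E).
Proof.
move=> K K0 wbar bound.
(* The convention w_(-1) = z_0 makes the second choice start like the first, with zero as the second
   term of the potential. *)
have q0 : q 0%N = z 0%N by case: choice => -[qE _]; rewrite qE// z_init.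
have choice' : (forall k, q k = z k) /\ alpha <= 1 / L
    \/ (forall k, q k.+1 = w k) /\ alpha <= 1 / (2 * L).
  by case: choice => -[qE aL]; [left | right]; split=> // k; rewrite qE.
have [[rN _] rc _] := r_pcl.
have wfin k : r (w k) \is a fin_num by rewrite w_step prox_fin_num.
(* Each term of a gap supremum is bounded separately: [u] is fixed in [B], and z_0 in [B] lets the
   diameter replace |z_0 - u|. *)
have gap_le (G : 'rV[R]_m -> \bar R) u a : B u -> r u = a%:E -> econvex G ->
    (forall k, G (w k) <= (fine (r (w k)) + dotv (F (w k)) (w k - u) - a)%:E)%E ->
    (G wbar <= bound)%E.
  move=> Bu ru Gc Gw.
  apply: (le_trans (averaged_gap_le _ _ _ _ _ _ _ L_gt0 F_lipschitz r_pcl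
    alpha_gt0 q0 w_step z_step choice' _ _ _ _ K0 ru Gc Gw)).
  rewrite lee_fin ler_wpM2r ?invr_ge0 ?mulr_ge0 ?(ltW alpha_gt0)//.
  have le_diam : enorm (z 0%N - u) <= diam B by rewrite z_init enorm_diam.
  by rewrite lerXn2r ?nnegrE ?(le_trans _ le_diam) ?enorm_ge0.
split.
  apply: ge_ereal_sup => _ [u Bu <-].
  (* A point with r(u) = +oo contributes -oo to the supremum, so only finite values of r(u)
     remain. *)
  case ru : (r u) (rN u) => [a| |]// _; last first.
    by rewrite addeNy leNye.
  pose G x := ((dotv (F u) (x - u))%:E + r x - a%:E)%E.
  apply: (gap_le G u a) => //.
    have -> : G = (fun x => (dotv (F u) (x - u) - a)%:E + r x)%E.
      by apply/funext => x; rewrite /G EFinB addeAC.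
    apply: econvexD => //; apply: econvex_EFin => x y t _.
    rewrite le_eqVlt; apply/orP; left; apply/eqP; rewrite !dotv_simpl; ring.
  move=> k; rewrite /G -(fineK (wfin k)) -EFinN -!EFinD lee_fin.
  (* Monotonicity replaces F(u), which makes [G] affine up to [r], by F(w_k), which the descent
     inequality controls. *)
  have := F_monotone (w k) u; rewrite dotvDl dotvNl /=; lra.
move=> d n e Phi f h mm.
apply: ge_ereal_sup => _ [u Bu <-].
have [Phic Phicc _ _ [[fN _] fc _] [[hN _] hc _] _ rE] := mm.
set x := xpart e u; set y := ypart e u.
case fx : (f x) (fN x) => [a| |]// _; last first.
  (* finiteness of h at the average rules out the junk value +oo - +oo = -oo *)
  have hw : (h (ypart e wbar) <= (K%:R^-1 *
      \sum_(k < K) fine (h (ypart e (w k))))%:E)%E.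
    apply: (econvex_mean (fun v => h (ypart e v)) w
      (fun k => fine (h (ypart e (w k)))) K) => //.
      exact: econvex_ypart.
    move=> k; have := wfin k; rewrite rE.
    by case: (f _) => [s| |]//; case: (h _) => [t| |].
  rewrite /saddle fx.
  case: (h (ypart e wbar)) (hN (ypart e wbar)) hw => [t| |]// _ _.
  by rewrite !addye// addeNy leNye.
case hy : (h y) (hN y) => [b| |]// _; last first.
  by rewrite /saddle hy addeNy addNye leNye.
(* The saddle difference is regrouped by blocks: the first summand is convex in the x-block, the
   second in the y-block, and the constants a, b go with the first. *)
pose G v := ((f (xpart e v) + (Phi (xpart e v) y - b - a)%:E) +
  ((- Phi x (ypart e v))%:E + h (ypart e v)))%E.
have GE v : (saddle Phi f h (xpart e v) y - saddle Phi f h x (ypart e v))%E = G v.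
  rewrite /G /saddle fx hy.
  move: (fN (xpart e v)) (hN (ypart e v)).
  case: (f (xpart e v)) => [s| |]//; case: (h (ypart e v)) => [t| |]// _ _.
  rewrite -!(EFinD, EFinN); congr EFin; ring.
rewrite GE; apply: (gap_le G u (a + b)) => //.
- by rewrite rE fx hy.
- rewrite /G; apply: econvexD => [v|v||].
  + by move: (fN (xpart e v)); case: (f _).
  + by move: (hN (ypart e v)); case: (h _).
  + apply: (econvex_xpart e (fun v => f v + (Phi v y - b - a)%:E)%E).
    apply: econvexD => //; apply: econvex_EFin => v v' t t01.
    have := convex_functionE _ (Phic y) v v' t t01; lra.
  + apply: (econvex_ypart e (fun v => (- Phi x v)%:E + h v)%E).
    apply: econvexD => //; apply: econvex_EFin => v v' t t01.
    exact: convex_functionE (Phicc x) v v' t t01.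
- move=> k; have := saddle_gap_le _ _ _ _ _ _ _ (w k) u mm; rewrite -/x -/y.
  (* Finiteness of r(w_k) forces both [f] and [h] to be finite at the blocks of w_k. *)
  have := wfin k; rewrite /G rE.
  case: (f _) => [s| |]//; case: (h _) => [t| |]//= _.
  by rewrite lee_fin; lra.
Qed.
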